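(* Let $G=(V,E)$ be a finite connected graph (undirected and loopless) with at least three vertices, and let $F$ be a graph clustering algorithm on $G$. Then $F$ cannot simultaneously satisfy Scale-Invariance, Consistency and Connected-Richness.
   Context: A pseudo-distance on a graph $G=(V,E)$ is a function $d\colon V\times V\to\mathbb{R}$ with $d(v,w)=d(w,v)\ge 0$ and $d(v,v)=0$ for all $v,w$, such that $d(v,w)\ne 0$ if and only if $(v,w)\in E$ (equivalently, a positive weight function on the undirected edges). A graph clustering algorithm on $G$ is a function $F$ from the set of pseudo-distances on $G$ to the set of partitions of $V$. For a partition $\mathcal{P}$ of $V$, $v\sim_{\mathcal{P}}w$ means $v,w$ lie in the same cluster of $\mathcal{P}$. A partition of $V$ is connected if each of its clusters induces a connected subgraph of $G$. Scale-Invariance: $F(\alpha\cdot d)=F(d)$ for every pseudo-distance $d$ on $G$ and every $\alpha>0$. Consistency: for all pseudo-distances $d,d'$ on $G$, with $\mathcal{P}=F(d)$, if $d'(v,w)\le d(v,w)$ whenever $v\sim_{\mathcal{P}}w$ and $d'(v,w)\ge d(v,w)$ whenever $v\not\sim_{\mathcal{P}}w$, then $F(d')=F(d)$. Connected-Richness: for every connected partition $\mathcal{P}$ of $V$ there exists a pseudo-distance $d$ on $G$ with $F(d)=\mathcal{P}$. *)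

(* Defs.v *)
From HB Require Import structures.
From mathcomp Require Import all_boot all_order all_algebra.
From mathcomp Require Import reals.
Set Implicit Arguments.
Unset Strict Implicit.
Unset Printing Implicit Defensive.
Import Order.TTheory GRing.Theory Num.Theory.
Local Open Scope ring_scope.

(* A graph on V is given by its adjacency relation e : rel V; e being          *)
(* symmetric (undirected) and irreflexive (loopless) is assumed where needed.  *)

Definition graph_connected (V : finType) (e : rel V) : Prop :=
  forall v w : V, connect e v w.

Definition induced (V : finType) (e : rel V) (C : {set V}) : rel V :=
  [rel x y | [&& x \in C, y \in C & e x y]].

Definition induces_connected (V : finType) (e : rel V) (C : {set V}) : Prop :=
  {in C &, forall v w, connect (induced e C) v w}.

Definition is_pseudodist (R : realType) (V : finType) (e : rel V)
    (d : {ffun V * V -> R}) : bool :=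
  [forall v, forall w,
    [&& d (v, w) == d (w, v), 0 <= d (v, w), d (v, v) == 0
      & (d (v, w) != 0) == e v w]].

(* Finite functions with a boolean predicate, so that two pseudo-distances     *)
(* with the same values are equal.                                             *)
Record pseudodist (R : realType) (V : finType) (e : rel V) := PseudoDist {
  pseudodist_val :> {ffun V * V -> R};
  _ : is_pseudodist e pseudodist_val }.

HB.instance Definition _ (R : realType) (V : finType) (e : rel V) :=
  [isSub for @pseudodist_val R V e].

Lemma scale_subproof (R : realType) (V : finType) (e : rel V) (a : R)
    (a_gt0 : 0 < a) (d : pseudodist R e) :
  is_pseudodist e [ffun p => a * d p].
Proof.
apply/'forall_forallP => v w; rewrite !ffunE.
have /'forall_forallP/(_ v w)/and4P[/eqP dC d_ge0 /eqP dvv /eqP <-] := valP d.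
apply/and4P; split.
- by apply/eqP; rewrite dC.
- exact: mulr_ge0 (ltW a_gt0) d_ge0.
- by apply/eqP; rewrite dvv mulr0.
- by rewrite mulf_eq0 (gt_eqF a_gt0).
Qed.

Definition scale (R : realType) (V : finType) (e : rel V) (a : R)
    (a_gt0 : 0 < a) (d : pseudodist R e) : pseudodist R e :=
  PseudoDist (scale_subproof a_gt0 d).

(* MathComp's partition requires the clusters to be nonempty. *)
Definition vpartition (V : finType) : Type :=
  {P : {set {set V}} | partition P [set: V]}.

Definition same_cluster (V : finType) (P : vpartition V) : rel V :=
  [rel v w | [exists C in val P, (v \in C) && (w \in C)]].

Definition connected_partition (V : finType) (e : rel V)
    (P : vpartition V) : Prop :=
  forall C : {set V}, C \in val P -> induces_connected e C.

Definition clustering_algorithm (R : realType) (V : finType) (e : rel V) : Type :=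
  pseudodist R e -> vpartition V.

Definition scale_invariance (R : realType) (V : finType) (e : rel V)
    (F : clustering_algorithm R e) : Prop :=
  forall (d : pseudodist R e) (a : R) (a_gt0 : 0 < a), F (scale a_gt0 d) = F d.

Definition consistency (R : realType) (V : finType) (e : rel V)
    (F : clustering_algorithm R e) : Prop :=
  forall d d' : pseudodist R e,
    (forall v w : V, same_cluster (F d) v w -> d' (v, w) <= d (v, w)) ->
    (forall v w : V, ~~ same_cluster (F d) v w -> d (v, w) <= d' (v, w)) ->
    F d' = F d.

Definition connected_richness (R : realType) (V : finType) (e : rel V)
    (F : clustering_algorithm R e) : Prop :=
  forall P : vpartition V, connected_partition e P ->
    exists d : pseudodist R e, F d = P.

(* Main.v *)
(* If F d yields the partition into singletons then, by Consistency, so does F  *)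
(* on every pseudo-distance dominating d. On a finite graph any pseudo-distance *)
(* dominates d after a large enough rescaling, so Scale-Invariance makes F      *)
(* constant, although Connected-Richness requires it to reach {V} as well.      *)
Require Import Defs.
From mathcomp Require Import all_boot all_order all_algebra.
From mathcomp Require Import reals.
Import Order.TTheory GRing.Theory Num.Theory.

(** Pick [d] with [F d] the singletons and [d'] with [F d'] the one-cluster partition. All
    pseudo-distances on [e] vanish at the same pairs, so some multiple of [d'] dominates [d]
    ([scale_dominates]). Passing from [d] to that multiple only increases distances between clusters
    of [F d], hence both partitions coincide, contradicting [singletons_neq_whole]. *)

Section Pseudodist.
Local Open Scope ring_scope.
Context {R : realType} {V : finType} {e : rel V}.
Implicit Type d : pseudodist R e.

Lemma pseudodist_ge0 d p : 0 <= d p.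
Proof.
case: p => v w.
by have /'forall_forallP/(_ v w)/and4P[] := valP d.
Qed.

Lemma pseudodist_diag d v : d (v, v) = 0.
Proof. by have /'forall_forallP/(_ v v)/and4P[_ _ /eqP] := valP d. Qed.

Lemma pseudodist_neq0 d v w : (d (v, w) != 0) = e v w.
Proof. by have /'forall_forallP/(_ v w)/and4P[_ _ _ /eqP] := valP d. Qed.

(** Off the edges both sides vanish; on the finitely many edges [d'] is positive, so the ratios
    [d p / d' p] are bounded. *)
Lemma scale_dominates d d' :
  exists (a : R) (a_gt0 : 0 < a), forall p, d p <= scale a_gt0 d' p.
Proof.
have quot_ge0 p : 0 <= d p / d' p by rewrite divr_ge0 ?pseudodist_ge0.
(* The sum bounds each of its nonnegative terms, with quotients by zero equal to 0 by convention;
   the 1 makes the factor positive even if [e] has no edges. *)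
have a_gt0 : 0 < 1 + \sum_p d p / d' p by rewrite ltr_wpDr ?sumr_ge0.
exists (1 + \sum_p d p / d' p), a_gt0 => -[v w]; rewrite ffunE.
have [evw|nevw] := boolP (e v w); last first.
  by move: nevw; rewrite -(pseudodist_neq0 d) negbK => /eqP->;
     rewrite mulr_ge0 ?pseudodist_ge0 ?ltW.
have d'_gt0 : 0 < d' (v, w) by rewrite lt0r pseudodist_neq0 evw pseudodist_ge0.
rewrite -ler_pdivrMr // (bigD1 (v, w)) //= addrCA lerDl.
by rewrite addr_ge0 ?sumr_ge0.
Qed.

End Pseudodist.

Lemma partition_singletons (V : finType) :
  partition [set [set v] | v : V] [set: V].
Proof.
apply/and3P; split.
- by rewrite -subTset; apply/subsetP => v _; apply/bigcupP;
     exists [set v]; rewrite ?imset_f ?set11.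
- apply/trivIsetP => _ _ /imsetP[v _ ->] /imsetP[w _ ->] vw.
  by rewrite disjoints1 inE; apply: contraNneq vw => ->.
- by apply/imsetP => -[v _ /setP/(_ v)]; rewrite !inE eqxx.
Qed.

Lemma partition_whole (V : finType) :
  0 < #|V| -> partition [set [set: V]] [set: V].
Proof.
move=> V_gt0; rewrite /partition /cover /trivIset /cover !big_set1 !eqxx inE /=.
by rewrite eq_sym -card_gt0 cardsT.
Qed.

Definition singletons (V : finType) : vpartition V :=
  exist (fun P : {set {set V}} => partition P [set: V]) _
    (partition_singletons V).

Definition whole (V : finType) (V_gt0 : 0 < #|V|) : vpartition V :=
  exist (fun P : {set {set V}} => partition P [set: V]) _
    (partition_whole V V_gt0).

Lemma same_cluster_singletons (V : finType) (v w : V) :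
  same_cluster (singletons V) v w = (v == w).
Proof.
apply/existsP/eqP => [[C /and3P[/imsetP[x _ ->]]]|->].
  by rewrite !inE => /eqP-> /eqP->.
by exists [set w]; rewrite imset_f ?set11.
Qed.

Lemma connected_singletons (V : finType) (e : rel V) :
  connected_partition e (singletons V).
Proof.
move=> C /imsetP[x _ ->] v w.
by rewrite !inE => /eqP-> /eqP->; apply: connect0.
Qed.

Lemma connected_whole (V : finType) (e : rel V) (V_gt0 : 0 < #|V|) :
  graph_connected e -> connected_partition e (whole V V_gt0).
Proof.
move=> e_conn C; rewrite inE => /eqP-> v w _ _.
have /eq_connect->: induced e [set: V] =2 e.
  by move=> x y; rewrite /induced /= !in_setT.
exact: e_conn.
Qed.

(** Otherwise [[set: V]] would itself be a singleton, of cardinality 1. *)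
Lemma singletons_neq_whole (V : finType) (V_gt0 : 0 < #|V|) :
  1 < #|V| -> singletons V <> whole V V_gt0.
Proof.
move=> V_gt1 /(congr1 val)/= /setP/(_ setT); rewrite set11.
by case/imsetP=> x _ /(congr1 (fun A : {set V} => #|A|)) cardV;
   move: V_gt1; rewrite -cardsT cardV cards1.
Qed.

Theorem theorem20 (R : realType) (V : finType) (e : rel V)
    (e_sym : symmetric e) (e_irr : irreflexive e)
    (e_conn : graph_connected e) (V_ge3 : (3 <= #|V|)%N)
    (F : clustering_algorithm R e) :
  ~ (scale_invariance F /\ consistency F /\ connected_richness F).
Proof.
move=> [F_scale [F_cons F_rich]].
have V_gt1 : 1 < #|V| := ltnW V_ge3.
have V_gt0 : 0 < #|V| := ltnW V_gt1.
have [d Fd] := F_rich _ (connected_singletons V e).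
have [d' Fd'] := F_rich _ (connected_whole V e V_gt0 e_conn).
have [a [a_gt0 d_le]] := scale_dominates d d'.
apply: (singletons_neq_whole V V_gt0 V_gt1).
(* Between clusters, Consistency asks for exactly [d_le]; within a cluster of [F d] only diagonal
   pairs remain, where both distances are 0. *)
rewrite -Fd -Fd' -(F_scale d' a a_gt0); apply/esym/F_cons => v w //.
by rewrite Fd same_cluster_singletons => /eqP->; rewrite !pseudodist_diag.
Qed.
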